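(* Let $0<p\le 1$, let $K,H\subseteq\mathbb{R}^n$ be $p$-convex sets, and let $\nu\in\mathbb{R}$. Then both $K+H=\{k+h : k\in K,\ h\in H\}$ and $\nu K=\{\nu k : k\in K\}$ are $p$-convex sets.
   Context: For $0<p\le 1$, a set $K\subseteq\mathbb{R}^n$ is called $p$-convex if $\lambda x+\mu y\in K$ for every $x,y\in K$ and all $\lambda,\mu\ge 0$ with $\lambda^p+\mu^p=1$. *)

(* Defs.v *)
From mathcomp Require Import all_boot all_order all_algebra.
From mathcomp Require Import all_classical all_reals all_analysis.

Set Implicit Arguments.
Unset Strict Implicit.
Unset Printing Implicit Defensive.

Import Order.TTheory GRing.Theory Num.Theory.
Local Open Scope classical_set_scope.
Local Open Scope ring_scope.

(* Meant for 0 < p <= 1; for such p, [0 `^ p = 0], so that the endpoints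
   (lambda, mu) = (1, 0) and (0, 1) satisfy the constraint, as usual. *)
Definition p_convex (R : realType) (n : nat) (p : R) (K : set 'rV[R]_n) : Prop :=
  forall x y : 'rV[R]_n, K x -> K y ->
  forall lambda mu : R, 0 <= lambda -> 0 <= mu ->
    lambda `^ p + mu `^ p = 1 -> K (lambda *: x + mu *: y).

(* Main.v *)
Require Import Defs.
From mathcomp Require Import all_boot all_order all_algebra.
From mathcomp Require Import all_classical all_reals all_analysis.

Import Order.TTheory GRing.Theory Num.Theory.
Local Open Scope classical_set_scope.
Local Open Scope ring_scope.

(** Forming a combination with coefficients [l], [m] commutes with sums and with scaling by [nu]: a
    combination of points [k + h], [k' + h'] is the sum of the combinations in [K] and in [H], with
    the same coefficients, so the constraint on them passes unchanged to the hypotheses. *)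

Theorem theorem3p9 (R : realType) (n : nat) (p : R) (p_gt0 : 0 < p)
    (p_le1 : p <= 1) (K H : set 'rV[R]_n)
    (K_pconvex : p_convex p K) (H_pconvex : p_convex p H) (nu : R) :
  p_convex p [set k + h | k in K & h in H] /\
  p_convex p [set nu *: k | k in K].
Proof.
split.
- move=> _ _ [k Kk [h Hh <-]] [k' Kk' [h' Hh' <-]] l m l0 m0 lm1.
  exists (l *: k + m *: k'); first exact: K_pconvex.
  exists (l *: h + m *: h'); first exact: H_pconvex.
  by rewrite !scalerDr addrACA.
- move=> _ _ [k Kk <-] [k' Kk' <-] l m l0 m0 lm1.
  exists (l *: k + m *: k'); first exact: K_pconvex.
  (* The pattern flips only products with [nu] on the left, so the repeated commutation
     terminates. *)
  by rewrite scalerDr !scalerA ![nu * _]mulrC.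
Qed.
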